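(* Let $h>0$ and let $\lambda,\mu\in\mathbb{R}$ satisfy $\mu>0$, $3\lambda+2\mu>0$. The functions $N_{\mathrm{DF}}$ and $N_{\mathrm{FD}}$ (given by the explicit formulas in the context) admit the two-term asymptotic expansions, as $\Lambda\to+\infty$, $$N_{\mathrm{DF}}(\Lambda)=\frac{2h}3\left(\frac2{\mu^{3/2}}+\frac1{(\lambda+2\mu)^{3/2}}\right)\Lambda^{3/2}-\frac{\pi}{2(\lambda+2\mu)}\Lambda+o(\Lambda),$$ $$N_{\mathrm{FD}}(\Lambda)=\frac{2h}3\left(\frac2{\mu^{3/2}}+\frac1{(\lambda+2\mu)^{3/2}}\right)\Lambda^{3/2}+\frac{\pi}{2(\lambda+2\mu)}\Lambda+o(\Lambda).$$
   Context: Let $r_2(n)=\#\{(a,b)\in\mathbb{Z}^2 : n=a^2+b^2\}$ and let $\lfloor\cdot\rfloor$ be the floor function. For $\Lambda>0$, $$N_{\mathrm{DF}}(\Lambda)=\left\lfloor\frac h\pi\sqrt{\frac\Lambda{\lambda+2\mu}}\right\rfloor+\sum_{n=1}^{\lfloor\Lambda/\mu\rfloor}r_2(n)\left(2\left\lfloor\frac h\pi\sqrt{\frac\Lambda\mu-n}\right\rfloor+1\right)+\sum_{n=1}^{\lfloor\Lambda/(\lambda+2\mu)\rfloor}r_2(n)\left\lfloor\frac h\pi\sqrt{\frac\Lambda{\lambda+2\mu}-n}\right\rfloor,$$ $$N_{\mathrm{FD}}(\Lambda)=N_{\mathrm{DF}}(\Lambda)+\sum_{n=1}^{\lfloor\Lambda/(\lambda+2\mu)\rfloor}r_2(n).$$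 *)

(* Defs.v *)
From mathcomp Require Import all_boot all_order all_algebra finmap.
From mathcomp Require Import all_classical all_reals all_analysis.
Import Order.TTheory GRing.Theory Num.Theory.
Import numFieldNormedType.Exports.

Set Implicit Arguments.
Unset Strict Implicit.
Unset Printing Implicit Defensive.

Local Open Scope classical_set_scope.
Local Open Scope ring_scope.

(* The Landau notations take a filter_on, and the library declares no canonical
   instance at +oo. *)
Canonical pinfty_filter_on (R : numFieldType) : filter_on R :=
  FilterType (pinfty_nbhs R) _.

Definition two_squares (n : nat) : set (int * int) :=
  [set p : int * int | n%:Z = p.1 ^+ 2 + p.2 ^+ 2].

(* fset_set is the empty finite set on infinite sets, so the cardinal in r2
   is meaningful only thanks to this lemma. *)
Lemma finite_two_squares (n : nat) : finite_set (two_squares n).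
Proof.
pose g (q : (bool * 'I_n.+1) * (bool * 'I_n.+1)) : int * int :=
  ((-1) ^+ q.1.1 * (q.1.2 : nat)%:Z, (-1) ^+ q.2.1 * (q.2.2 : nat)%:Z).
apply: (@sub_finite_set _ _ (g @` setT)); last first.
  by apply: finite_image; exact: finite_finset.
move=> [a b] /= nab.
have nE : n = (`|a| ^ 2 + `|b| ^ 2)%N.
  apply/eqP; rewrite -eqz_nat nab PoszD -!abszX !gez0_abs ?sqr_ge0 //.
have le_sq (m : nat) : (m <= m ^ 2)%N by case: m => // m; rewrite leq_pmulr.
have ha : (`|a| < n.+1)%N by rewrite ltnS nE (leq_trans (le_sq _)) ?leq_addr.
have hb : (`|b| < n.+1)%N by rewrite ltnS nE (leq_trans (le_sq _)) ?leq_addl.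
exists ((a < 0, Ordinal ha), (b < 0, Ordinal hb)) => //.
by rewrite /g /= -!intEsign.
Qed.

Definition r2 (n : nat) : nat := #|` fset_set (two_squares n)|%fset.

(* Num.truncn x is the floor of x, as a natural number, when x >= 0;
   Num.floor takes its values in int. *)
Definition N_DF (R : realType) (h lambda mu L : R) : int :=
  Num.floor (h / pi * Num.sqrt (L / (lambda + 2 * mu)))
  + \sum_(1 <= n < (Num.truncn (L / mu)).+1)
      (r2 n)%:Z * (2 * Num.floor (h / pi * Num.sqrt (L / mu - n%:R)) + 1)
  + \sum_(1 <= n < (Num.truncn (L / (lambda + 2 * mu))).+1)
      (r2 n)%:Z
      * Num.floor (h / pi * Num.sqrt (L / (lambda + 2 * mu) - n%:R)).

Definition N_FD (R : realType) (h lambda mu L : R) : int :=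
  N_DF h lambda mu L
  + \sum_(1 <= n < (Num.truncn (L / (lambda + 2 * mu))).+1) (r2 n)%:Z.

(* Main.v *)
Require Import Defs.
From mathcomp Require Import all_boot all_order all_algebra finmap.
From mathcomp Require Import all_classical all_reals all_analysis.
From mathcomp Require Import ring lra zify.
Import Order.TTheory GRing.Theory Num.Theory.
Import numFieldNormedType.Exports.

Set Implicit Arguments.
Unset Strict Implicit.
Unset Printing Implicit Defensive.

Local Open Scope classical_set_scope.
Local Open Scope ring_scope.

(** Put c = h / pi, and let A(y) be the number of points of Z^2 in the disc
    x1^2 + x2^2 <= y.  In the sum of r2(n) floor(c sqrt(x - n)) over
    1 <= n <= x, write the floor as the number of integers k >= 1 with
    n <= x - k^2 / c^2 and exchange the two sums: what is counted is the
    lattice points in the layers k >= 1 of the ellipsoid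
    x1^2 + x2^2 + k^2 / c^2 <= x, the axis removed, that is, the sum of
    A(x - k^2 / c^2) - 1 over 1 <= k <= c sqrt x ([layer_sumE]).  With pi y
    in place of A(y), the formula for a sum of squares turns this into
    pi (2/3 c x^(3/2) - x / 2) up to O(sqrt x) ([sum_layer_radii_small]); the
    term - pi x / 2 is the missing half of the layer k = 0.  Since pi c = h,
    these are the two coefficients of the expansion: at x = L / mu the
    weights 2 floor(..) + 1 put the layer k = 0 back and no term of order L
    is left, at x = L / (lambda + 2 mu) the term - pi x / 2 survives in N_DF,
    and N_FD adds the full layer pi x.

    There are about c sqrt x layers and the total error has to be o(x), so
    the circle problem has to be solved with error o(sqrt n), better than
    the O(sqrt n) that comes from the length of the boundary
    ([gauss_circle]).  By the eightfold symmetry of the disc, A(n) is an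
    explicit combination of the floors of sqrt(n - a^2) for
    1 <= a <= sqrt(n / 2), a range in which the slope of the arc is bounded.
    The midpoint rule computes the sum of the arc itself up to O(1)
    ([sum_arc]), so everything rests on the cancellation in the sum of the
    sawtooth of sqrt(n - a^2).

    That cancellation ([sum_sawtooth_small]) is van der Corput's method with
    soft constants.  Near a given a the arc is almost linear; take p / q
    close to minus its slope by Dirichlet's theorem.  On a block of q
    consecutive integers the values are then almost t - i p / q, which modulo
    1 run through a translate of the multiples of 1 / q; their sawtooth sum is
    the sawtooth of the single number q t, and on the block the sum is at most
    5, whatever q ([sawtooth_block]).  Blocks with q >= Q thus cost 5 / Q per
    term.  The other blocks lie where the slope is close to a fraction of
    denominator less than Q, and few integers do, because the slope of the arc
    moves at a rate at least comparable to 1 / r, r being the radius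
    ([count_spread]). *)

(** * The sawtooth function on short blocks *)

Section Sawtooth.
Variable R : archiRealFieldType.
Implicit Types (x y d : R).

Lemma natr_truncn x : 0 <= x -> (Num.truncn x)%:R = (Num.floor x)%:~R :> R.
Proof. by move=> x0; rewrite truncn_floor x0 pmulrn gez0_abs// floor_ge0. Qed.

Definition sawtooth x : R := x - (Num.floor x)%:~R - 2^-1.

Lemma sawtooth_bound x : `|sawtooth x| <= 2^-1.
Proof.
have := floor_itv x; rewrite intrD /sawtooth => /andP[h1 h2].
by rewrite ler_norml; apply/andP; split; lra.
Qed.

(** Monotonicity of the floor makes a perturbation by at most d cost 2 d, even
    across the jumps, once the sawtooth is evaluated at the shifted points
    x + d and x - d: a whole progression can then be shifted at once. *)
Lemma sawtooth_near x y d : `|y - x| <= d ->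
  sawtooth (x + d) - 2 * d <= sawtooth y <= sawtooth (x - d) + 2 * d.
Proof.
rewrite ler_norml => /andP[h1 h2].
have f1 : (Num.floor y)%:~R <= (Num.floor (x + d))%:~R :> R.
  by rewrite ler_int; apply: le_floor; lra.
have f2 : (Num.floor (x - d))%:~R <= (Num.floor y)%:~R :> R.
  by rewrite ler_int; apply: le_floor; lra.
by rewrite /sawtooth; apply/andP; split; lra.
Qed.

(** The distribution relation of the first Bernoulli function.  As p is prime
    to q, the integers floor (q x) + i p run through all residues modulo q, so
    the fractional parts of the x + i p / q are the (j + phi) / q, 0 <= j < q,
    where phi is the fractional part of q x. *)
Lemma sum_sawtooth_distribution (q : nat) (p : int) x :
  (0 < q)%N -> coprime `|p| q ->
  \sum_(i < q) sawtooth (x + i%:R * (p%:~R / q%:R)) = sawtooth (q%:R * x).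
Proof.
move=> q_gt0 pq.
have q0 : q%:R != 0 :> R by rewrite pnatr_eq0 -lt0n.
have qz0 : q%:Z != 0 by rewrite -lt0n in q_gt0 *; lia.
pose n := Num.floor (q%:R * x); pose phi := q%:R * x - n%:~R.
have /andP[phi_ge0 phi_lt1] : 0 <= phi < 1.
  have := floor_itv (q%:R * x); rewrite intrD -/n /phi => /andP[h1 h2].
  by apply/andP; split; lra.
pose z (i : 'I_q) : int := n + i%:Z * p.
have zlt i : (`|(z i %% q)%Z| < q)%N.
  by have := ltz_pmod (z i) (isT : 0 < 1%:Z); have := modz_ge0 (z i) qz0;
     have := @ltz_pmod (z i) q; lia.
pose s i := Ordinal (zlt i).
have s_inj : injective s.
  move=> i j /(congr1 val)/= sij.
  have {sij} : (z i = z j %[mod q])%Z.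
    by have := modz_ge0 (z i) qz0; have := modz_ge0 (z j) qz0; lia.
  move/eqP; rewrite eqz_mod_dvd /z.
  have -> : n + i%:Z * p - (n + j%:Z * p) = p * (i%:Z - j%:Z) by ring.
  rewrite Gauss_dvdzr; last by rewrite coprimezE coprime_sym.
  move=> /dvdzP[k hk]; apply: val_inj => /=.
  have := ltn_ord i; have := ltn_ord j.
  have [k0|k0|k0] := ltgtP k 0; nia.
have termE (i : 'I_q) : sawtooth (x + i%:R * (p%:~R / q%:R))
    = ((s i)%:R + phi) / q%:R - 2^-1.
  have sE : (s i)%:R = ((z i %% q)%Z)%:~R :> R.
    by rewrite /s /= pmulrn gez0_abs // modz_ge0.
  have xE : x + i%:R * (p%:~R / q%:R)
      = (z i %/ q)%Z%:~R + ((s i)%:R + phi) / q%:R.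
    have zE : (z i)%:~R = (z i %/ q)%Z%:~R * q%:R + (s i)%:R :> R.
      by rewrite sE {1}(divz_eq (z i) q) intrD intrM.
    have : (z i)%:~R + phi = q%:R * (x + i%:R * (p%:~R / q%:R)).
      by rewrite /z /phi intrD intrM; field.
    by rewrite zE => h; apply: (mulfI q0); rewrite -h; field.
  have q_gt0' : 0 < q%:R :> R by rewrite ltr0n.
  have flE : Num.floor (x + i%:R * (p%:~R / q%:R)) = (z i %/ q)%Z.
    apply: floor_def; rewrite intrD xE lerDl ltrD2l.
    rewrite divr_ge0 ?(addr_ge0 (ler0n _ _) phi_ge0) //=.
    rewrite mulr1z ltr_pdivrMr // mul1r.
    have : (s i).+1%:R <= q%:R :> R by rewrite ler_nat.
    by rewrite -natr1; lra.
  by rewrite /sawtooth flE xE; ring.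
rewrite (eq_bigr _ (fun i _ => termE i)).
rewrite sumrB -mulr_suml big_split /=.
have -> : \sum_(i < q) (s i)%:R = \sum_(i < q) i%:R :> R.
  by rewrite [RHS](reindex_inj s_inj).
have -> : \sum_(i < q) i%:R = q%:R * (q%:R - 1) / 2 :> R.
  elim: (q) => [|k IH]; first by rewrite big_ord0 mul0r mul0r.
  by rewrite big_ord_recr /= IH -natr1; field.
rewrite !sumr_const card_ord -(mulr_natl phi) -(mulr_natl 2^-1).
by rewrite /sawtooth -/n -/phi; field.
Qed.

(** For points close to a progression of step p / q there is no loss
    proportional to q beyond that of the perturbation. *)
Lemma sum_sawtooth_near_rational (q : nat) (p : int) x d (y : nat -> R) :
  (0 < q)%N -> coprime `|p| q ->
  (forall i, (i < q)%N -> `|y i - (x + i%:R * (p%:~R / q%:R))| <= d) ->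
  `|\sum_(i < q) sawtooth (y i)| <= 2 * q%:R * d + 2^-1.
Proof.
move=> q_gt0 pq hy.
have shift e : \sum_(i < q) sawtooth (x + i%:R * (p%:~R / q%:R) + e)
    = sawtooth (q%:R * (x + e)).
  rewrite -(sum_sawtooth_distribution _ q_gt0 pq).
  by apply: eq_bigr => i _; rewrite addrAC.
have const_sum : \sum_(i < q) (2 * d) = q%:R * (2 * d).
  by rewrite sumr_const card_ord -(mulr_natl (2 * d)).
have lb : sawtooth (q%:R * (x + d)) - q%:R * (2 * d)
    <= \sum_(i < q) sawtooth (y i).
  rewrite -shift -const_sum -sumrB; apply: ler_sum => i _.
  by case/andP: (sawtooth_near (hy i (ltn_ord i))).
have ub : \sum_(i < q) sawtooth (y i)
    <= sawtooth (q%:R * (x - d)) + q%:R * (2 * d).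
  rewrite -shift -const_sum -big_split /=; apply: ler_sum => i _.
  by case/andP: (sawtooth_near (hy i (ltn_ord i))).
have := sawtooth_bound (q%:R * (x + d)).
have := sawtooth_bound (q%:R * (x - d)).
rewrite !ler_norml => /andP[h1 h2] /andP[h3 h4].
by apply/andP; split; lra.
Qed.

(** Pigeonhole: among the fractional parts of 0, alpha, .., N alpha two lie in
    the same interval of length 1 / N.  Dividing the resulting fraction by its
    greatest common divisor only improves the approximation. *)
Lemma dirichlet_approximation (alpha : R) (N : nat) : 0 <= alpha -> (0 < N)%N ->
  exists q p : nat, [/\ (0 < q <= N)%N, coprime p q
    & `|q%:R * alpha - p%:R| <= N%:R^-1].
Proof.
move=> a_ge0 N_gt0; have N0 : 0 < N%:R :> R by rewrite ltr0n.
pose fr (i : nat) : R := i%:R * alpha - (Num.truncn (i%:R * alpha))%:R.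
have frP i : 0 <= fr i < 1.
  have /andP[] := truncn_itv (mulr_ge0 (ler0n R i) a_ge0).
  by rewrite /fr -natr1; lra.
(* The N + 1 fractional parts are sorted into the N intervals of length 1 / N. *)
have boxP (i : 'I_N.+1) : (Num.truncn (N%:R * fr i) < N)%N.
  have /andP[h1 h2] := frP i.
  rewrite truncn_lt_nat; last by rewrite mulr_ge0// ltW.
  by rewrite gtr_pMr.
pose box i := Ordinal (boxP i).
have : ~~ injectiveb box.
  apply/negP => /injectiveP/leq_card; by rewrite !card_ord ltnn.
move=> /injectivePn[i [j ij bij]].
wlog lt_ij : i j ij bij / (i < j)%N.
  move=> wl; have [h|h|h] := ltngtP i j; first exact: (wl i j).
    by apply: (wl j i) => //; rewrite eq_sym.
  by move: ij; rewrite (val_inj h) eqxx.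
have frB : `|fr j - fr i| <= N%:R^-1.
  have /andP[hi1 hi2] := truncn_itv (mulr_ge0 (ltW N0) (proj1 (andP (frP i)))).
  have /andP[hj1 hj2] := truncn_itv (mulr_ge0 (ltW N0) (proj1 (andP (frP j)))).
  move: bij => /(congr1 val)/= bij; move: hi1 hi2; rewrite bij => hi1 hi2.
  rewrite -(ler_pM2l N0) mulfV ?gt_eqF// -{1}(gtr0_norm N0) -normrM.
  by rewrite ler_norml; move: hi2 hj2; rewrite -natr1; lra.
pose q0 := (j - i)%N.
pose p0 := (Num.truncn (j%:R * alpha) - Num.truncn (i%:R * alpha))%N.
have approx0 : `|q0%:R * alpha - p0%:R| <= N%:R^-1.
  have le_tr : (Num.truncn (i%:R * alpha) <= Num.truncn (j%:R * alpha))%N.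
    by apply: le_truncn; rewrite ler_wpM2r// ler_nat ltnW.
  rewrite (natrB _ (ltnW lt_ij)) (natrB _ le_tr).
  apply: le_trans frB; rewrite /fr le_eqVlt; apply/orP; left; apply/eqP.
  by congr `|_|; ring.
have q0_gt0 : (0 < q0)%N by rewrite subn_gt0.
have q0N : (q0 <= N)%N by rewrite /q0; have := ltn_ord j; lia.
pose g := gcdn p0 q0; have g_gt0 : (0 < g)%N by rewrite gcdn_gt0 q0_gt0 orbT.
have qE : q0 = (q0 %/ g * g)%N by rewrite divnK ?dvdn_gcdr.
have pE : p0 = (p0 %/ g * g)%N by rewrite divnK ?dvdn_gcdl.
exists (q0 %/ g)%N, (p0 %/ g)%N; split.
- rewrite divn_gt0// dvdn_leq ?dvdn_gcdr//=.
  by rewrite (leq_trans _ q0N)// leq_div.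
- rewrite /coprime -(eqn_pmul2r g_gt0) mul1n muln_gcdl -qE -pE.
  exact: eqxx.
- apply: le_trans approx0; rewrite {2}qE {2}pE !natrM mulrAC -mulrBl.
  rewrite normrM [X in _ <= _ * X]ger0_norm// ler_peMr//.
  by rewrite (_ : 1 = 1%:R)// ler_nat.
Qed.

(** Greedy cutting: from every a far enough from m, a block of length at most N
    is available whose sum is paid for by the weights w.  The additive N covers
    the last, incomplete, block. *)
Lemma sum_blocks (N m : nat) (g w : nat -> R) :
  (forall a, `|g a| <= 1) -> (forall a, 0 <= w a) ->
  (forall a, (a + N <= m)%N -> exists q, (0 < q <= N)%N /\
     `|\sum_(i < q) g (a + i)%N| <= \sum_(i < q) w (a + i)%N) ->
  `|\sum_(0 <= a < m) g a| <= \sum_(0 <= a < m) w a + N%:R.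
Proof.
move=> g1 w0 blocks.
suff H k : forall a, (m - a <= k)%N -> (a <= m)%N ->
    `|\sum_(a <= b < m) g b| <= \sum_(a <= b < m) w b + N%:R.
  by apply: (H m); rewrite ?subn0.
elim: k => [|k IH] a mak am.
  have -> : a = m by lia.
  by rewrite !big_geq// normr0 add0r.
have [aN|aN] := leqP (a + N)%N m.
  have [q [/andP[q0 qN] hq]] := blocks a aN.
  have split_sum (F : nat -> R) : \sum_(a <= b < m) F b
      = \sum_(i < q) F (a + i)%N + \sum_(a + q <= b < m) F b.
    rewrite (@big_cat_nat _ _ _ (a + q))//=; [|lia..].
    congr (_ + _); rewrite -{1}[a]add0n big_addn addKn big_mkord.
    by apply: eq_bigr => i _; rewrite addnC.
  rewrite !split_sum -addrA; apply: le_trans (ler_normD _ _) _.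
  by apply: lerD => //; apply: IH; lia.
apply: le_trans (ler_norm_sum _ _ _) _.
apply: (@le_trans _ _ (\sum_(a <= b < m) 1)); first exact: ler_sum.
rewrite sumr_const_nat -[leLHS]add0r; apply: lerD.
  by apply: sumr_ge0 => i _.
by rewrite ler_nat; lia.
Qed.

(** Consecutive values of s are at least kappa apart, so an interval of length
    2 d contains at most 2 d / kappa + 1 of them. *)
Lemma count_spread (kappa c d : R) (m : nat) (s : nat -> R) :
  0 < kappa -> 0 <= d ->
  (forall a i, (a + i < m)%N -> kappa * i%:R <= s (a + i)%N - s a) ->
  \sum_(0 <= a < m) (`|s a - c| <= d)%R%:R <= 2 * d / kappa + 1.
Proof.
move=> k0 d0 spread; rewrite big_mkord.
have rhs0 : 0 <= 2 * d / kappa by rewrite divr_ge0 ?(ltW k0)// mulr_ge0.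
have [none|/existsP[b hb]] := boolP [forall a : 'I_m, ~~ (`|s a - c| <= d)].
  rewrite big1 ?addr_ge0// => a _.
  by rewrite (negbTE (forallP none a)).
rewrite negbK in hb.
case: (@arg_minnP _ b (fun a : 'I_m => `|s a - c| <= d) (fun a => a : nat) hb)
  => a0 ha0 amin.
pose K := Num.truncn (2 * d / kappa).
apply: (@le_trans _ _ K.+1%:R); last first.
  by rewrite -natr1 lerD2r truncn_le.
apply: (@le_trans _ _ (\sum_(a < m) ((a0 <= a) && (a < a0 + K.+1))%N%:R)).
  apply: ler_sum => a _; rewrite ler_nat.
  have [ha|//] := boolP (`|s a - c| <= d).
  have a0a := amin a ha; rewrite a0a /=.
  (* All the indices counted lie within K of the smallest one, a0. *)
  suff: (a - a0 <= K)%N by lia.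
  rewrite truncn_ge_nat// ler_pdivlMr// mulrC.
  have := spread a0 (a - a0)%N; rewrite subnKC// => /(_ (ltn_ord a)).
  by move/le_trans; apply; move: ha ha0; rewrite !ler_norml; lra.
rewrite -natr_sum ler_nat.
have -> k : (\sum_(a < k) ((a0 <= a) && (a < a0 + K.+1))
    = minn k (a0 + K.+1) - a0)%N.
  by elim: k => [|k IH]; [rewrite big_ord0|rewrite big_ord_recr /= IH]; lia.
by lia.
Qed.

(** * Equidistribution of sequences with slowly varying slope *)

(** The hypothesis on r makes the curvature negligible on a block of length at
    most N: both the quadratic error B i^2 / r and the drift B i / r of the
    slope stay below 1 / N, the precision of Dirichlet's approximation p / q of
    the slope at a.  The perturbation is then at most 2 / N, and costs at most
    4 q / N <= 4 on the block. *)
Lemma sawtooth_block (B r : R) (N m : nat) (f s : nat -> R) :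
  1 <= B -> (0 < N)%N -> B * N%:R ^+ 3 <= r ->
  (forall a, (a < m)%N -> 0 <= s a <= B) ->
  (forall a i, (a + i < m)%N ->
     `|f (a + i)%N - (f a - s a * i%:R)| <= B * i%:R ^+ 2 / r) ->
  (forall a i, (a + i < m)%N ->
     i%:R / (B * r) <= s (a + i)%N - s a <= B * i%:R / r) ->
  forall a, (a + N <= m)%N ->
  exists q p : nat, [/\ (0 < q <= N)%N,
    p%:R <= q%:R * B + 1,
    `|\sum_(i < q) sawtooth (f (a + i)%N)| <= 5 &
    forall i, (i < q)%N -> `|s (a + i)%N - p%:R / q%:R| <= 2 / N%:R].
Proof.
move=> B1 N_gt0 r_big sB fapprox sgap a aN.
have B0 : 0 < B by apply: lt_le_trans B1.
have N0 : 0 < N%:R :> R by rewrite ltr0n.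
have N1 : 1 <= N%:R :> R by rewrite (_ : 1 = 1%:R)// ler_nat.
have r0 : 0 < r by apply: lt_le_trans r_big; rewrite mulr_gt0// exprn_gt0.
have am : (a < m)%N by apply: leq_trans aN; rewrite -addn1 leq_add2l.
have cube_r : B * N%:R ^+ 2 / r <= N%:R^-1.
  rewrite ler_pdivrMr// [N%:R^-1 * _]mulrC ler_pdivlMr//.
  by rewrite -mulrA -exprSr.
have lin_r : B * N%:R / r <= N%:R^-1.
  apply: le_trans cube_r; rewrite ler_pM2r ?invr_gt0// ler_pM2l//.
  by rewrite expr2 ler_peMl// ltW.
have /andP[sa0 saB] := sB a am.
have [q [p [/andP[q_gt0 qN] pq approx]]] := dirichlet_approximation sa0 N_gt0.
have q0 : 0 < q%:R :> R by rewrite ltr0n.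
have q1 : 1 <= q%:R :> R by rewrite (_ : 1 = 1%:R)// ler_nat.
have sapprox : `|s a - p%:R / q%:R| <= N%:R^-1 / q%:R.
  rewrite ler_pdivlMr// -{2}(gtr0_norm q0) -normrM mulrBl divfK ?gt_eqF//.
  by rewrite mulrC.
have aim i : (i < q)%N -> (a + i < m)%N.
  by move=> iq; apply: leq_trans aN; rewrite ltn_add2l (leq_trans iq).
exists q, p; split.
- by rewrite q_gt0.
- have : N%:R^-1 <= 1 :> R by rewrite invf_le1.
  have : q%:R * s a <= q%:R * B by rewrite ler_pM2l.
  by move: approx; rewrite ler_norml; clear; lra.
- apply: (@le_trans _ _ (2 * q%:R * (2 / N%:R) + 2^-1)).
    (* The graph has slope - s a at a, hence the sign of p. *)
    apply: (sum_sawtooth_near_rational (p := - p%:Z) (x := f a)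
              (y := fun i => f (a + i)%N)) => //.
      by rewrite abszN.
    move=> i iq.
    have iN : i%:R <= N%:R :> R by rewrite ler_nat ltnW// (leq_trans iq).
    have iq' : i%:R <= q%:R :> R by rewrite ler_nat ltnW.
    have -> : f (a + i)%N - (f a + i%:R * ((- p%:Z)%:~R / q%:R))
      = (f (a + i)%N - (f a - s a * i%:R)) - i%:R * (s a - p%:R / q%:R).
      by rewrite rmorphN /= -pmulrn; ring.
    apply: le_trans (ler_normB _ _) _.
    rewrite [2 / _]mulr_natl mulr2n; apply: lerD.
      apply: le_trans (fapprox _ _ (aim _ iq)) _; apply: le_trans cube_r.
      by rewrite ler_pM2r ?invr_gt0// ler_pM2l// lerXn2r// ?nnegrE.
    rewrite normrM ger0_norm//.
    apply: (@le_trans _ _ (q%:R * (N%:R^-1 / q%:R))); last first.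
      by rewrite mulrC divfK ?gt_eqF.
    by apply: ler_pM.
  have : q%:R / N%:R <= 1 :> R by rewrite ler_pdivrMr// mul1r ler_nat.
  by rewrite !mulrA; clear; lra.
- move=> i iq; have /andP[h1 h2] := sgap _ _ (aim _ iq).
  have h3 : 0 <= i%:R / (B * r).
    by rewrite divr_ge0// mulr_ge0// ltW.
  have h4 : B * i%:R / r <= N%:R^-1.
    apply: le_trans lin_r; rewrite ler_pM2r ?invr_gt0// ler_pM2l// ler_nat.
    by rewrite ltnW// (leq_trans iq).
  have h5 : N%:R^-1 / q%:R <= N%:R^-1 :> R.
    by rewrite ler_pdivrMr// ler_peMr// ltW// invr_gt0.
  move: sapprox h1 h2 h3 h4 h5; rewrite !ler_norml; clear; lra.
Qed.

(** Cancellation for the values of a function with slope - s, curvature of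
    order 1 / r and length at most r.  The constant C depends on B and eps only:
    this uniformity is what allows the radius of the disc to vary. *)
Lemma sum_sawtooth_small (B eps : R) : 1 <= B -> 0 < eps ->
  exists C, forall (r : R) (m : nat) (f s : nat -> R),
    0 < r -> m%:R <= r ->
    (forall a, (a < m)%N -> 0 <= s a <= B) ->
    (forall a i, (a + i < m)%N ->
       `|f (a + i)%N - (f a - s a * i%:R)| <= B * i%:R ^+ 2 / r) ->
    (forall a i, (a + i < m)%N ->
       i%:R / (B * r) <= s (a + i)%N - s a <= B * i%:R / r) ->
    `|\sum_(0 <= a < m) sawtooth (f a)| <= eps * r + C.
Proof.
move=> B1 eps0; have B0 : 0 < B by lra.
(* Blocks with denominator at least Q contribute 5 r / Q at most.  There are
   Q P <= 3 Q^2 B fractions of smaller denominator, and each is close to at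
   most 4 B r / N + 1 slopes; N = Q^3 makes this 12 B^2 r / Q + O(1). *)
pose Q := (Num.truncn ((5 + 12 * B ^+ 2) / eps)).+1.
have Q0 : 0 < Q%:R :> R by rewrite ltr0n.
have Q1 : 1 <= Q%:R :> R by rewrite (_ : 1 = 1%:R)// ler_nat.
have QE : (5 + 12 * B ^+ 2) / Q%:R <= eps.
  rewrite ler_pdivrMr// [eps * _]mulrC -ler_pdivrMr//.
  by apply: ltW; exact: truncnS_gt.
pose N := (Q ^ 3)%N.
have NE : N%:R = Q%:R ^+ 3 :> R by rewrite natrX.
have N_gt0 : (0 < N)%N by rewrite expn_gt0.
have N0 : 0 < N%:R :> R by rewrite ltr0n.
have N1 : 1 <= N%:R :> R by rewrite (_ : 1 = 1%:R)// ler_nat.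
(* Numerators p of the fractions p / q that can approximate a slope s <= B
   when q < Q are less than P. *)
pose P := (Num.truncn (Q%:R * B + 1)).+1.
have PE : P%:R <= 3 * Q%:R * B.
  have QB : 1 <= Q%:R * B by rewrite mulr_ege1.
  have : (Num.truncn (Q%:R * B + 1))%:R <= Q%:R * B + 1 by rewrite truncn_le; lra.
  by rewrite /P -natr1; lra.
exists (B * N%:R ^+ 3 + Q%:R * P%:R + N%:R) => r m f s r0 mr sB fapprox sgap.
(* Below the threshold of sawtooth_block the trivial bound is a constant. *)
have [r_small|r_big] := ltP r (B * N%:R ^+ 3).
  apply: le_trans (ler_norm_sum _ _ _) _.
  apply: (@le_trans _ _ (\sum_(0 <= a < m) 1)).
    by apply: ler_sum => a _; apply: le_trans (sawtooth_bound _) _; lra.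
  rewrite sumr_const_nat subn0.
  have : 0 <= eps * r by rewrite mulr_ge0// ltW.
  have : 0 <= Q%:R * P%:R :> R by rewrite mulr_ge0.
  by lra.
(* The weight of a term is its share 5 / Q of a long block, plus at least 1 when
   its slope is close to a fraction of small denominator: such a term pays for
   itself in a short block. *)
pose near_frac a (q p : nat) : bool := `|s a - p%:R / q%:R| <= 2 / N%:R.
pose bad a : R := \sum_(q < Q) \sum_(p < P) (near_frac a q p)%:R.
pose w a : R := 5 / Q%:R + bad a.
have bad0 a : 0 <= bad a by apply: sumr_ge0 => q _; apply: sumr_ge0.
have w0 a : 0 <= w a by rewrite addr_ge0// divr_ge0// ltW.
have saw1 (x : R) : `|sawtooth x| <= 1.
  by apply: le_trans (sawtooth_bound x) _; lra.
have blocks a : (a + N <= m)%N -> exists q, (0 < q <= N)%N /\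
    `|\sum_(i < q) sawtooth (f (a + i)%N)| <= \sum_(i < q) w (a + i)%N.
  move=> aN.
  have [q [p [/andP[q_gt0 qN] pB sum5 near_p]]] :=
    sawtooth_block B1 N_gt0 r_big sB fapprox sgap aN.
  have q0 : 0 < q%:R :> R by rewrite ltr0n.
  exists q; split; first by rewrite q_gt0.
  have [Qq|qQ] := leqP Q q.
    apply: le_trans sum5 _.
    rewrite /w big_split /= sumr_const card_ord -[leLHS]addr0.
    apply: lerD; last by apply: sumr_ge0.
    rewrite -[_ *+ q]mulr_natl mulrCA ler_peMr//.
    by rewrite ler_pdivlMr// mul1r ler_nat.
  apply: le_trans (ler_norm_sum _ _ _) _; apply: ler_sum => i _.
  apply: (@le_trans _ _ 1); first exact: saw1.
  rewrite /w -[leLHS]add0r; apply: lerD; first by rewrite divr_ge0// ltW.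
  have pP : (p < P)%N.
    rewrite ltnS truncn_ge_nat; last by rewrite addr_ge0// mulr_ge0// ltW.
    apply: le_trans pB _; rewrite lerD2r ler_pM2r// ler_nat.
    exact: ltnW.
  rewrite /bad (bigD1 (Ordinal qQ))//= (bigD1 (Ordinal pP))//=.
  rewrite [near_frac _ _ _]near_p// -addrA lerDl addr_ge0//.
    by apply: sumr_ge0.
  by apply: sumr_ge0 => ? _; apply: sumr_ge0.
apply: le_trans (sum_blocks (g := fun a => sawtooth (f a))
  (fun a => saw1 (f a)) w0 blocks) _.
rewrite !addrA lerD2r.
have bad_sum : \sum_(0 <= a < m) bad a <= Q%:R * P%:R * (4 * B * r / N%:R + 1).
  rewrite exchange_big /=.
  apply: (@le_trans _ _ (\sum_(q < Q) \sum_(p < P) (4 * B * r / N%:R + 1))).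
    apply: ler_sum => q _; rewrite exchange_big /=; apply: ler_sum => p _.
    have -> : 4 * B * r / N%:R = 2 * (2 / N%:R) / (B * r)^-1.
      by rewrite invrK; ring.
    apply: count_spread; rewrite ?invr_gt0 ?mulr_gt0// ?divr_ge0//.
    by move=> a i aim; rewrite mulrC; case/andP: (sgap a i aim).
  rewrite !sumr_const !card_ord -mulrnA -[_ *+ (P * Q)]mulr_natl natrM.
  by rewrite [P%:R * _]mulrC.
rewrite /w big_split /= sumr_const_nat subn0.
have m5 : 5 / Q%:R *+ m <= 5 / Q%:R * r.
  by rewrite -[_ *+ m]mulr_natr ler_pM2l// divr_gt0.
have main : Q%:R * P%:R * (4 * B * r / N%:R) <= 12 * B ^+ 2 / Q%:R * r.
  have -> : 12 * B ^+ 2 / Q%:R * r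
      = Q%:R * (3 * Q%:R * B) * (4 * B * r / N%:R).
    by rewrite NE; field; rewrite gt_eqF.
  rewrite ler_pM2r ?divr_gt0 ?mulr_gt0//.
  by rewrite ler_pM2l.
have : (5 + 12 * B ^+ 2) / Q%:R * r <= eps * r by rewrite ler_pM2r.
have : 0 <= B * N%:R ^+ 3 by rewrite mulr_ge0 ?exprn_ge0// ltW.
move: bad_sum; rewrite mulrDr mulr1 mulrDl; clear -m5 main.
lra.
Qed.
End Sawtooth.

(** * Lattice points in a disc, octant by octant *)

Definition circle_count (n : nat) : nat := (\sum_(k < n.+1) r2 k)%N.

(** The interval [-M, M], listed by sign so that the sum of an even function
    splits at once. *)
Definition signed_iota (M : nat) : seq int :=
  0 :: [seq a%:Z | a <- iota 1 M] ++ [seq - a%:Z | a <- iota 1 M].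

Arguments signed_iota : simpl never.

Lemma mem_signed_iota (M : nat) (x : int) :
  (x \in signed_iota M) = (`|x| <= M)%N.
Proof.
rewrite inE mem_cat; apply/idP/idP.
  case/or3P => [/eqP->//|/mapP[a]|/mapP[a]]; rewrite mem_iota => aM ->.
    by rewrite absz_nat; lia.
  by rewrite abszN absz_nat; lia.
move=> xM; have [//|x0] := eqVneq x 0; apply/orP; right; apply/orP.
have [xp|xn] := lerP 0 x.
  by left; apply/mapP; exists `|x|%N; rewrite ?mem_iota; lia.
by right; apply/mapP; exists `|x|%N; rewrite ?mem_iota; lia.
Qed.

Lemma uniq_signed_iota (M : nat) : uniq (signed_iota M).
Proof.
rewrite /signed_iota /= mem_cat cat_uniq !map_inj_uniq ?iota_uniq /= ?andbT; last first.
- by move=> a b [].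
- by move=> a b /oppr_inj[].
apply/andP; split.
  by apply/norP; split; apply/mapP => -[a]; rewrite mem_iota => ? ?; lia.
apply/hasP => -[x /mapP[a]]; rewrite mem_iota => a1 -> /mapP[b].
by rewrite mem_iota => ? ?; lia.
Qed.

Lemma sum_signed_iota (M : nat) (F : nat -> nat) :
  (\sum_(x <- signed_iota M) F `|x| = F 0 + 2 * \sum_(1 <= a < M.+1) F a)%N.
Proof.
rewrite big_cons absz0 big_cat !big_map /= /index_iota subn1 /=.
rewrite mul2n -addnn; congr (_ + (_ + _))%N.
by apply: eq_bigr => a _; rewrite abszN.
Qed.

(** The range of summation does not depend on n, only on a bound M: the sum over
    n <= M can then be moved inside. *)
Lemma r2E (n M : nat) : (n <= M)%N ->
  r2 n = (\sum_(x <- signed_iota M) \sum_(y <- signed_iota M)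
           (`|x| ^ 2 + `|y| ^ 2 == n))%N.
Proof.
move=> nM.
pose s := [seq p <- [seq (x, y) | x <- signed_iota M, y <- signed_iota M] |
  (`|p.1| ^ 2 + `|p.2| ^ 2 == n)%N].
have memE p : (p \in s) = (`|p.1| ^ 2 + `|p.2| ^ 2 == n)%N.
  rewrite mem_filter andb_idr// => /eqP nE; case: p nE => x y nE.
  rewrite -[(x, y).1]/x -[(x, y).2]/y in nE.
  have le_sq (m : nat) : (m <= m ^ 2)%N by case: m => // m; rewrite leq_pmulr.
  apply/allpairsPdep; exists x, y; split => //; rewrite mem_signed_iota.
    by rewrite (leq_trans (le_sq _))// (leq_trans _ nM)// -nE leq_addr.
  by rewrite (leq_trans (le_sq _))// (leq_trans _ nM)// -nE leq_addl.
have us : uniq s.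
  apply: filter_uniq; apply: allpairs_uniq; try exact: uniq_signed_iota.
  by move=> [? ?] [? ?].
have -> : r2 n = size s.
  rewrite /r2 -(undup_id us) -card_fseq; congr #|` _|%fset.
  apply/fsetP => p; rewrite in_fset_set ?inE; last exact: finite_two_squares.
  rewrite memE; apply/idP/idP.
    rewrite inE /two_squares /= => h.
    by apply/eqP/eqP; rewrite -eqz_nat h PoszD -!abszX !gez0_abs ?sqr_ge0.
  move=> /eqP h; rewrite inE /two_squares /= -h.
  by rewrite PoszD -!abszX !gez0_abs ?sqr_ge0.
rewrite -sum1_size big_filter big_mkcond big_allpairs_dep.
by apply: eq_bigr => x _; apply: eq_bigr => y _ /=; case: (_ == _).
Qed.

Lemma circle_countE (n : nat) :
  (circle_count n = 1 + 4 * \sum_(1 <= b < n.+1) (b ^ 2 <= n)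
   + 4 * \sum_(1 <= a < n.+1) \sum_(1 <= b < n.+1) (a ^ 2 + b ^ 2 <= n))%N.
Proof.
have -> : circle_count n = (\sum_(x <- signed_iota n) \sum_(y <- signed_iota n)
    (`|x| ^ 2 + `|y| ^ 2 <= n))%N.
  rewrite /circle_count.
  rewrite (eq_bigr _ (fun (k : 'I_n.+1) _ => r2E (ltn_ord k : k <= n)%N)).
  rewrite exchange_big /=; apply: eq_bigr => x _.
  rewrite exchange_big /=; apply: eq_bigr => y _.
  have [le|gt] := leqP; last first.
    by rewrite big1// => k _; have := ltn_ord k; case: eqP => //; lia.
  rewrite (bigD1 (Ordinal (le : _ < n.+1)%N))//= eqxx big1// => k kne.
  by case: eqP => // kE; case/eqP: kne; apply: val_inj.
under eq_bigr => x _ do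
  rewrite (sum_signed_iota n (fun b => (`|x| ^ 2 + b ^ 2 <= n)%N : nat)).
rewrite (sum_signed_iota n (fun a => (a ^ 2 + 0 ^ 2 <= n)%N
  + 2 * \sum_(1 <= b < n.+1) (a ^ 2 + b ^ 2 <= n))%N).
rewrite big_split /= -big_distrr /=.
under [X in (_ + 2 * (X + _))%N]eq_bigr => a _ do rewrite exp0n// addn0.
under [X in (_ + 2 * X + _)%N]eq_bigr => a _ do rewrite exp0n// add0n.
by lia.
Qed.

(** Points with both coordinates positive: m is the integer part of
    sqrt (n / 2), so that no point has both coordinates beyond m and all those
    with both coordinates at most m are in the disc.  Hence the count is that
    of a <= m, plus that of b <= m, minus the square counted twice. *)
Lemma octant_count (n m : nat) : (2 * m ^ 2 <= n)%N -> (n < 2 * m.+1 ^ 2)%N ->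
  (\sum_(1 <= a < n.+1) \sum_(1 <= b < n.+1) (a ^ 2 + b ^ 2 <= n) + m ^ 2
   = 2 * \sum_(1 <= a < m.+1) \sum_(1 <= b < n.+1) (a ^ 2 + b ^ 2 <= n))%N.
Proof.
move=> mn nm.
have mlen : (m <= n)%N.
  by apply: leq_trans mn; case: (m) => // k; rewrite -mulnn; nia.
have cut (F : nat -> nat) :
  (\sum_(1 <= a < m.+1) F a = \sum_(1 <= a < n.+1) (a <= m) * F a)%N.
  rewrite (@big_cat_nat _ _ _ m.+1 1 n.+1)//= [X in (_ + X)%N]big1_seq ?addn0.
    by apply: eq_big_nat => a /andP[_ am]; rewrite -ltnS am mul1n.
  by move=> a; rewrite mem_index_iota => /andP[_ /andP[ma _]]; rewrite leqNgt ma.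
have sq : (m ^ 2
    = \sum_(1 <= a < n.+1) \sum_(1 <= b < n.+1) (a <= m) * (b <= m))%N.
  have -> : (m ^ 2 = \sum_(1 <= a < m.+1) \sum_(1 <= b < m.+1) 1)%N.
    by rewrite !sum_nat_const_nat subn1 /= muln1 mulnn.
  rewrite cut; apply: eq_bigr => a _; rewrite cut big_distrr /=.
  by apply: eq_bigr => b _; rewrite muln1.
(* The identity now holds pair by pair, for the indicators of a <= m and
   b <= m. *)
rewrite sq cut mul2n -addnn.
have swap :
  (\sum_(1 <= a < n.+1) (a <= m) * \sum_(1 <= b < n.+1) (a ^ 2 + b ^ 2 <= n)
   = \sum_(1 <= a < n.+1) \sum_(1 <= b < n.+1)
       (b <= m) * (a ^ 2 + b ^ 2 <= n))%N.
  rewrite [RHS]exchange_big /=; apply: eq_bigr => a _; rewrite big_distrr /=.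
  by apply: eq_bigr => b _; rewrite addnC.
rewrite {2}swap -!big_split /=; apply: eq_bigr => a _.
rewrite big_distrr -!big_split /=; apply: eq_bigr => b _.
have [am|am] := leqP a m; have [bm|bm] := leqP b m => /=.
- have -> : (a ^ 2 + b ^ 2 <= n)%N; last by [].
  by apply: leq_trans mn; rewrite mul2n -addnn leq_add// leq_sqr.
- by rewrite !mul0n !addn0 mul1n.
- by rewrite !mul0n add0n mul1n addn0.
- rewrite !mul0n; have -> : (a ^ 2 + b ^ 2 <= n)%N = false; last by [].
  apply/negbTE; rewrite -ltnNge; apply: leq_trans nm _.
  by rewrite mul2n -addnn leq_add// leq_sqr.
Qed.

Lemma count_sqrt (R : realType) (n a : nat) : (a ^ 2 <= n)%N ->
  (\sum_(1 <= b < n.+1) (a ^ 2 + b ^ 2 <= n))%N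
  = Num.truncn (Num.sqrt (n%:R - a%:R ^+ 2 : R)).
Proof.
move=> an; set k := Num.truncn _.
have x0 : 0 <= n%:R - a%:R ^+ 2 :> R by rewrite subr_ge0 -natrX ler_nat.
have bk b : (a ^ 2 + b ^ 2 <= n)%N = (b <= k)%N.
  rewrite truncn_ge_nat ?sqrtr_ge0// -[b%:R]ger0_norm// -sqrtr_sqr.
  by rewrite ler_sqrt// lerBrDl -!natrX -natrD ler_nat.
have kn : (k <= n)%N.
  have := leqnn k; rewrite -bk => h; apply: leq_trans h.
  apply: (@leq_trans (k ^ 2)); last by rewrite leq_addl.
  by case: (k) => // j; rewrite leq_pmulr.
under eq_bigr => b _ do rewrite bk.
rewrite (@big_cat_nat _ _ _ k.+1 1 n.+1)//= [X in (_ + X)%N]big1_seq ?addn0.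
  rewrite (eq_big_nat _ _ (F2 := fun=> 1%N)); last first.
    by move=> b /andP[_]; rewrite ltnS => ->.
  by rewrite sum_nat_const_nat subn1 muln1.
by move=> b; rewrite mem_index_iota => /andP[_ /andP[kb _]]; rewrite leqNgt kb.
Qed.

(** * The circular arc and its primitive *)

Section Arc.
Variable R : realType.
Implicit Types (r u v : R).

Definition arc r u : R := Num.sqrt (r ^+ 2 - u ^+ 2).

Lemma sqr_arc r u : 0 <= u <= r -> arc r u ^+ 2 = r ^+ 2 - u ^+ 2.
Proof.
move=> /andP[u0 ur]; rewrite sqr_sqrtr// subr_ge0.
by rewrite lerXn2r// nnegrE (le_trans u0).
Qed.

Lemma arc_ge0 r u : 0 <= arc r u. Proof. exact: sqrtr_ge0. Qed.

(** The range u <= 4/5 r contains the octant u <= r / sqrt 2, with room for the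
    half cell that the midpoint rule adds at its end; on it the slope of the arc
    is at most 4/3. *)
Lemma arc_ge r u : 0 < r -> 0 <= u <= 4 / 5 * r -> 3 / 5 * r <= arc r u.
Proof.
move=> r0 /andP[u0 ur]; have ur' : 0 <= u <= r by apply/andP; split; lra.
by have := sqr_arc ur'; have := arc_ge0 r u; nra.
Qed.

Lemma arc_lipschitz r u v : 0 < r -> 0 <= u <= 4 / 5 * r ->
  0 <= v <= 4 / 5 * r -> `|arc r v - arc r u| <= 4 / 3 * `|v - u|.
Proof.
move=> r0 ur vr; have gu := arc_ge r0 ur; have gv := arc_ge r0 vr.
have /sqr_arc su : 0 <= u <= r by case/andP: ur => ? ?; apply/andP; split; lra.
have /sqr_arc sv : 0 <= v <= r by case/andP: vr => ? ?; apply/andP; split; lra.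
have s0 : 0 < arc r v + arc r u by lra.
have E : (arc r v - arc r u) * (arc r v + arc r u) = - ((v - u) * (v + u)).
  by transitivity (arc r v ^+ 2 - arc r u ^+ 2); [ring|rewrite su sv; ring].
rewrite -(ler_pM2r s0) -{1}(gtr0_norm s0) -normrM E normrN normrM.
move: ur vr => /andP[u0 ur] /andP[v0 vr].
rewrite (@ger0_norm _ (v + u)); last by rewrite addr_ge0.
by rewrite [4 / 3 * _]mulrC -mulrA ler_wpM2l//; lra.
Qed.

(** Only the square of the arc is needed: e being the distance to the tangent at
    u, e (arc v + arc u) is a sum of terms of size (v - u)^2. *)
Lemma arc_tangent r u v : 0 < r -> 0 <= u <= 4 / 5 * r ->
  0 <= v <= 4 / 5 * r ->
  `|arc r v - (arc r u - u / arc r u * (v - u))| <= 3 * (v - u) ^+ 2 / r.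
Proof.
move=> r0 ur vr; have gu := arc_ge r0 ur; have gv := arc_ge r0 vr.
have lip := arc_lipschitz r0 ur vr.
have /sqr_arc su : 0 <= u <= r by case/andP: ur => ? ?; apply/andP; split; lra.
have /sqr_arc sv : 0 <= v <= r by case/andP: vr => ? ?; apply/andP; split; lra.
have s0 : 0 < arc r v + arc r u by lra.
have au0 : 0 < arc r u by lra.
move: ur vr => /andP[u0 ur] /andP[v0 vr].
have slope : `|u / arc r u| <= 4 / 3.
  by rewrite ger0_norm ?divr_ge0 ?(ltW au0)// ler_pdivrMr//; lra.
set e := arc r v - _.
have E : e * (arc r v + arc r u)
    = u / arc r u * (v - u) * (arc r v - arc r u) - (v - u) ^+ 2.
  transitivity (arc r v ^+ 2 - arc r u ^+ 2
    + u / arc r u * (v - u) * (arc r v - arc r u) + 2 * u * (v - u)).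
    by rewrite /e; field; rewrite gt_eqF.
  by rewrite su sv; ring.
have E2 : `|e| * (arc r v + arc r u) <= 25 / 9 * (v - u) ^+ 2.
  rewrite -{1}(gtr0_norm s0) -normrM E; apply: le_trans (ler_normB _ _) _.
  rewrite (ger0_norm (sqr_ge0 _)) (normrM (_ * (v - u))) (normrM _ (v - u)).
  rewrite -[(v - u) ^+ 2]real_normK ?num_real//.
  have h : `|u / arc r u| * `|v - u| <= 4 / 3 * `|v - u| by rewrite ler_wpM2r.
  have := ler_pM (mulr_ge0 (normr_ge0 _) (normr_ge0 _)) (normr_ge0 _) h lip.
  set w := `|v - u|; rewrite !expr2.
  have -> : 4 / 3 * w * (4 / 3 * w) = 16 / 9 * (w * w) by field.
  lra.
have : `|e| * (6 / 5 * r) <= `|e| * (arc r v + arc r u).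
  by rewrite ler_wpM2l//; lra.
rewrite ler_pdivlMr//; have := sqr_ge0 (v - u); lra.
Qed.

Lemma arc_slope_gap r u v : 0 < r -> 0 <= u -> u <= v -> v <= 4 / 5 * r ->
  (v - u) / r <= v / arc r v - u / arc r u <= 5 * (v - u) / r.
Proof.
move=> r0 u0 uv vr.
have ur' : 0 <= u <= 4 / 5 * r by apply/andP; split; lra.
have vr' : 0 <= v <= 4 / 5 * r by apply/andP; split; lra.
have gu := arc_ge r0 ur'; have gv := arc_ge r0 vr'.
have lip := arc_lipschitz r0 ur' vr'.
have au0 : 0 < arc r u by lra.
have av0 : 0 < arc r v by lra.
have dec : arc r v <= arc r u.
  by apply: ler_wsqrtr; rewrite lerB// lerXn2r// nnegrE; lra.
have ar : arc r u <= r.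
  rewrite /arc -{2}(ger0_norm (ltW r0)) -sqrtr_sqr; apply: ler_wsqrtr.
  by rewrite gerBl sqr_ge0.
have -> : v / arc r v - u / arc r u
    = ((v - u) / arc r u) + v * (arc r u - arc r v) / (arc r u * arc r v).
  by field; rewrite !gt_eqF.
have h3 : 0 <= (v - u) / r by rewrite divr_ge0 ?subr_ge0// ltW.
apply/andP; split.
  apply: ler_wpDr; first by rewrite divr_ge0 ?mulr_ge0//; lra.
  by rewrite ler_wpM2l ?lef_pV2// ?subr_ge0.
have h1 : (v - u) / arc r u <= 5 / 3 * ((v - u) / r).
  have -> : 5 / 3 * ((v - u) / r) = (v - u) * (3 / 5 * r)^-1.
    by field; rewrite gt_eqF.
  by rewrite ler_wpM2l ?subr_ge0// lef_pV2// posrE mulr_gt0.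
have h2 : v * (arc r u - arc r v) / (arc r u * arc r v) <= 3 * ((v - u) / r).
  apply: (@le_trans _ _
    (4 / 5 * r * (4 / 3 * (v - u)) / (3 / 5 * r * (3 / 5 * r)))).
    apply: ler_pM.
    - by rewrite mulr_ge0// ?subr_ge0//; lra.
    - by rewrite invr_ge0 mulr_ge0// ltW.
    - apply: ler_pM => //; [lra|by rewrite subr_ge0|].
      by move: lip; rewrite distrC ger0_norm ?subr_ge0// ger0_norm ?subr_ge0.
    - rewrite lef_pV2 ?posrE ?mulr_gt0//.
      by apply: ler_pM => //; rewrite mulr_ge0// ltW.
  have -> : 4 / 5 * r * (4 / 3 * (v - u)) / (3 / 5 * r * (3 / 5 * r))
      = 80 / 27 * ((v - u) / r) by field; rewrite gt_eqF.
  by lra.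
by rewrite -mulrA; lra.
Qed.

(** The area under the arc: a triangle and a circular sector. *)
Definition arc_primitive r u : R :=
  (u * arc r u + r ^+ 2 * asin (u / r)) / 2.

Lemma is_derive_arc_primitive r u : 0 <= u < r ->
  is_derive u 1 (arc_primitive r) (arc r u).
Proof.
move=> /andP[u0 ur]; have r0 : 0 < r by lra.
have a0 : 0 < r ^+ 2 - u ^+ 2 by rewrite subr_gt0 ltrXn2r// nnegrE; lra.
have ar0 : 0 < arc r u by rewrite sqrtr_gt0.
have dp : is_derive u 1 (fun x : R => r ^+ 2 - x ^+ 2) (- (2 * u)).
  have := is_deriveB (is_derive_cst (r ^+ 2) u 1)
    (is_deriveX 2 (is_derive_id u (1 : R))).
  by move/is_derive_eq; apply; rewrite sub0r expr1 [_ *: _]mulr1.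
have darc : is_derive u 1 (arc r) ((2 * arc r u)^-1 * - (2 * u)).
  exact: (@is_derive1_comp _ Num.sqrt (fun x => r ^+ 2 - x ^+ 2) _ _ _
    (is_derive1_sqrt a0) dp).
have dq : is_derive u 1 (fun x : R => x / r) r^-1.
  have := is_deriveM (is_derive_id u (1 : R)) (is_derive_cst r^-1 u 1).
  by move/is_derive_eq; apply; rewrite scaler0 add0r; exact: mulr1.
have dasin : is_derive u 1 (fun x => asin (x / r))
    ((Num.sqrt (1 - (u / r) ^+ 2))^-1 * r^-1).
  apply: (@is_derive1_comp _ asin (fun x => x / r) _ _ _ _ dq).
  apply: is_derive1_asin.
  apply/andP; split; last by rewrite ltr_pdivrMr// mul1r.
  by apply: (@lt_le_trans _ _ 0) => //; rewrite divr_ge0// ltW.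
have sE : Num.sqrt (1 - (u / r) ^+ 2) = arc r u / r.
  have -> : 1 - (u / r) ^+ 2 = (r ^+ 2 - u ^+ 2) * (r^-1) ^+ 2.
    by field; rewrite gt_eqF.
  by rewrite sqrtrM ?ltW// sqrtr_sqr ger0_norm// invr_ge0 ltW.
have : is_derive u 1 (arc_primitive r)
   (((u * ((2 * arc r u)^-1 * - (2 * u)) + arc r u * 1)
    + r ^+ 2 * ((Num.sqrt (1 - (u / r) ^+ 2))^-1 * r^-1)) / 2).
  have := is_deriveM (is_deriveD (is_deriveM (is_derive_id u (1 : R)) darc)
    (is_deriveM (is_derive_cst (r ^+ 2) u 1) dasin))
    (is_derive_cst (2^-1 : R) u 1).
  by move/is_derive_eq; apply; rewrite !scaler0 add0r addr0 [RHS]mulrC.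
move/is_derive_eq; apply; rewrite sE.
have su : u ^+ 2 = r ^+ 2 - arc r u ^+ 2.
  by rewrite sqr_arc ?u0 ?ltW//; ring.
transitivity ((arc r u + (r ^+ 2 - u ^+ 2) / arc r u) / 2).
  by field; rewrite !gt_eqF.
by rewrite su; field; rewrite gt_eqF.
Qed.

(** The mean value theorem after subtraction of c + d x from the integrand: the
    comparison of the arc with a tangent line or with the diagonal of the
    octant. *)
Lemma arc_primitive_MVT r (c d a b : R) : 0 <= a -> a <= b -> b < r ->
  exists2 x, a <= x <= b &
    (arc_primitive r b - c * b - d * b ^+ 2 / 2)
      - (arc_primitive r a - c * a - d * a ^+ 2 / 2)
    = (arc r x - c - d * x) * (b - a).
Proof.
move=> a0 ab br.
pose F x := arc_primitive r x - c * x - d * x ^+ 2 / 2.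
have dF x : a <= x <= b -> is_derive x 1 F (arc r x - c - d * x).
  move=> /andP[ax xb].
  have xr : 0 <= x < r by rewrite (le_trans a0)// (le_lt_trans xb).
  have := is_deriveB (is_deriveB (is_derive_arc_primitive xr)
    (is_deriveM (is_derive_cst c x 1) (is_derive_id x (1 : R))))
    (is_deriveM (is_deriveM (is_derive_cst d x 1)
         (is_deriveX 2 (is_derive_id x (1 : R))))
       (is_derive_cst (2^-1 : R) x 1)).
  move/is_derive_eq; apply; rewrite !scaler0 !add0r !addr0.
  by rewrite /GRing.scale /= /cst; field.
have cF : {within `[a, b], continuous F}%classic.
  apply: derivable_within_continuous => z; rewrite in_itv /= => zab.
  have dFz := dF z zab; exact: ex_derive.
have [|y yab E] := @MVT_segment _ F (fun x => arc r x - c - d * x) a b ab _ cF.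
  by move=> x; rewrite in_itv /= => /andP[ax xb]; apply: dF; rewrite !ltW.
by exists y => //; move: yab; rewrite in_itv.
Qed.

(** The primitive of the tangent at a has increment exactly arc a over an
    interval centred at a, so only the quadratic error remains. *)
Lemma arc_primitive_midpoint r a : 0 < r -> 2^-1 <= a -> a + 2^-1 <= 4 / 5 * r ->
  `|arc_primitive r (a + 2^-1) - arc_primitive r (a - 2^-1) - arc r a| <= r^-1.
Proof.
move=> r0 a0 ar.
have h0 : 0 <= a - 2^-1 by lra.
have h1 : a - 2^-1 <= a + 2^-1 by lra.
have h2 : a + 2^-1 < r by lra.
pose s := a / arc r a.
have [x /andP[ax xa] E] := arc_primitive_MVT (arc r a + s * a) (- s) h0 h1 h2.
have ar' : 0 <= a <= 4 / 5 * r by apply/andP; split; lra.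
have xr : 0 <= x <= 4 / 5 * r by apply/andP; split; lra.
have := arc_tangent r0 ar' xr; rewrite -/s.
have -> : arc_primitive r (a + 2^-1) - arc_primitive r (a - 2^-1) - arc r a
    = arc r x - (arc r a - s * (x - a)).
  have -> : arc r x - (arc r a - s * (x - a))
    = (arc r x - (arc r a + s * a) - - s * x) * (a + 2^-1 - (a - 2^-1)).
    by field.
  by rewrite -E; field.
move=> h; apply: le_trans h _; rewrite ler_pdivrMr// mulVf ?gt_eqF//.
have : (x - a) ^+ 2 <= 2^-1 ^+ 2.
  rewrite -[(x - a) ^+ 2]real_normK ?num_real// lerXn2r ?nnegrE//.
  by rewrite ler_norml; lra.
by rewrite expr2; lra.
Qed.

Lemma arc_primitive0 r : arc_primitive r 0 = 0.
Proof.
have asin0 : asin (0 : R) = 0.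
  by rewrite -{1}(@sin0 R) sinK// in_itv /=; have := pi_gt0 R; lra.
by rewrite /arc_primitive !mul0r asin0 mulr0 addr0 mul0r.
Qed.

Lemma sin_pi4 : sin (pi / 4 : R) = (Num.sqrt 2)^-1.
Proof.
have pi0 := pi_gt0 R.
have s0 : 0 < sin (pi / 4 : R) by apply: sin_gt0_pi; lra.
have sq : sin (pi / 4 : R) ^+ 2 = 2^-1.
  have := cos_pihalf R.
  have -> : pi / 2 = pi / 4 *+ 2 :> R by rewrite mulr2n; field.
  by rewrite cos_mulr2n cos2sin2; lra.
by rewrite -[LHS]ger0_norm ?ltW// -sqrtr_sqr sq sqrtrV.
Qed.

Lemma arc_octant r : 0 < r -> arc r (r / Num.sqrt 2) = r / Num.sqrt 2.
Proof.
move=> r0; have s2 : 0 < Num.sqrt 2 :> R by rewrite sqrtr_gt0.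
rewrite -[RHS]ger0_norm; last by rewrite divr_ge0// ltW.
by rewrite -sqrtr_sqr /arc exprMn exprVn sqr_sqrtr//; congr Num.sqrt; field.
Qed.

Lemma arc_primitive_octant r : 0 < r ->
  arc_primitive r (r / Num.sqrt 2) - (r / Num.sqrt 2) ^+ 2 / 2 = pi / 8 * r ^+ 2.
Proof.
move=> r0; have s2 : 0 < Num.sqrt 2 :> R by rewrite sqrtr_gt0.
have sq : (r / Num.sqrt 2) ^+ 2 = r ^+ 2 / 2.
  by rewrite exprMn exprVn sqr_sqrtr.
rewrite /arc_primitive arc_octant// -expr2 sq.
have -> : r / Num.sqrt 2 / r = sin (pi / 4).
  by rewrite sin_pi4; field; rewrite !gt_eqF.
rewrite sinK; last by rewrite in_itv /=; have := pi_gt0 R; lra.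
by field.
Qed.

(** * The circle problem with error o(sqrt n) *)

Lemma octant_point_le r : 0 < r -> 0 <= r / Num.sqrt 2 <= 3 / 4 * r.
Proof.
move=> r0; have s2 : 0 < Num.sqrt 2 :> R by rewrite sqrtr_gt0.
rewrite divr_ge0 ?(ltW s2) ?(ltW r0)//= ler_pdivrMr//.
rewrite mulrAC -[leLHS]mul1r ler_pM2r//.
have : Num.sqrt 2 ^+ 2 = 2 :> R by rewrite sqr_sqrtr.
by nra.
Qed.

(** The midpoint rule gives the area under the arc from 1/2 to m + 1/2, up to
    m / r <= 1.  Subtracting the triangle below the diagonal leaves an area
    stationary at the octant point rho, so replacing m + 1/2 by rho costs O(1)
    and yields the sector, of area pi r^2 / 8; the piece from 0 to 1/2 is
    r / 2 up to O(1). *)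
Lemma sum_arc r (m : nat) : 10 <= r ->
  m%:R <= r / Num.sqrt 2 < m.+1%:R ->
  `|\sum_(1 <= a < m.+1) arc r a%:R
    - (pi / 8 * r ^+ 2 + (m%:R + 2^-1) ^+ 2 / 2 - r / 2)| <= 3.
Proof.
move=> r10 /andP[mrho rhom]; have r0 : 0 < r by lra.
set rho := r / Num.sqrt 2 in mrho rhom.
have /andP[_ rho_le] : 0 <= rho <= 3 / 4 * r by exact: octant_point_le.
move: rhom; rewrite -natr1 => rhom.
have m0 : 0 <= m%:R :> R by [].
have telescope : `|\sum_(1 <= a < m.+1) arc r a%:R
    - (arc_primitive r (m%:R + 2^-1) - arc_primitive r 2^-1)| <= 1.
  have -> : arc_primitive r (m%:R + 2^-1) - arc_primitive r 2^-1
    = \sum_(1 <= a < m.+1)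
        (arc_primitive r (a%:R + 2^-1) - arc_primitive r (a%:R - 2^-1)).
    rewrite (eq_bigr (fun a =>
      arc_primitive r (a.+1%:R - 2^-1) - arc_primitive r (a%:R - 2^-1))).
      rewrite telescope_sumr//; congr (arc_primitive r _ - arc_primitive r _).
        by rewrite -natr1; field.
      by field.
    by move=> a _; rewrite -natr1; congr (arc_primitive r _ - _); field.
  rewrite -sumrB; apply: le_trans (ler_norm_sum _ _ _) _.
  apply: (@le_trans _ _ (\sum_(1 <= a < m.+1) r^-1)).
    apply: ler_sum_nat => a /andP[a1 am]; rewrite distrC.
    have a1' : 1 <= a%:R :> R by rewrite (_ : 1 = 1%:R)// ler_nat.
    have am' : a%:R <= m%:R :> R by rewrite ler_nat.
    by apply: arc_primitive_midpoint => //; lra.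
  rewrite sumr_const_nat subn1 /= -mulr_natl ler_pdivrMr// mul1r.
  by lra.
have arc0 : arc r 0 = r.
  by rewrite /arc expr0n subr0 sqrtr_sqr gtr0_norm.
have half : `|arc_primitive r 2^-1 - r / 2| <= 2^-1.
  have h1 : 0 <= 2^-1 :> R by lra.
  have h2 : 2^-1 < r by lra.
  have [x /andP[x0 xh] E] := arc_primitive_MVT 0 0 (lexx 0) h1 h2.
  have u0 : 0 <= (0 : R) <= 4 / 5 * r by apply/andP; split; lra.
  have ux : 0 <= x <= 4 / 5 * r by apply/andP; split; lra.
  have := arc_lipschitz r0 u0 ux; rewrite arc0 subr0 (ger0_norm x0).
  move: E; rewrite arc_primitive0 => E.
  have -> : arc_primitive r 2^-1 = arc r x / 2 by lra.
  by rewrite !ler_norml; lra.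
(* The integrand arc x - x vanishes at rho and is Lipschitz, so it is bounded
   near rho, uniformly in r. *)
have step a b : 0 <= a -> a <= b -> b <= 4 / 5 * r ->
    a <= rho <= b -> b - a <= 2^-1 ->
    `|(arc_primitive r b - b ^+ 2 / 2) - (arc_primitive r a - a ^+ 2 / 2)| <= 1.
  move=> a0 ab br /andP[arho rhob] ba.
  have br' : b < r by lra.
  have [x /andP[ax xb] E] := arc_primitive_MVT 0 1 a0 ab br'.
  have -> : (arc_primitive r b - b ^+ 2 / 2) - (arc_primitive r a - a ^+ 2 / 2)
    = (arc r x - 0 - 1 * x) * (b - a) by rewrite -E; ring.
  have ux : 0 <= x <= 4 / 5 * r by apply/andP; split; lra.
  have urho : 0 <= rho <= 4 / 5 * r by apply/andP; split; lra.
  have := arc_lipschitz r0 urho ux; rewrite arc_octant// -/rho.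
  have d : `|x - rho| <= 2^-1 by rewrite ler_norml; apply/andP; split; lra.
  move=> h; rewrite normrM (@ger0_norm _ (b - a)) ?subr_ge0//.
  apply: (@le_trans _ _ (2 * 2^-1)); last by lra.
  apply: ler_pM => //; first by rewrite subr_ge0.
  have h' : `|arc r x - rho| <= 2 / 3 by lra.
  by move: h' d; rewrite !ler_norml; lra.
have octant : `|arc_primitive r (m%:R + 2^-1) - (m%:R + 2^-1) ^+ 2 / 2
    - pi / 8 * r ^+ 2| <= 1.
  rewrite -(arc_primitive_octant r0) -/rho.
  have [h|h] := lerP rho (m%:R + 2^-1).
    apply: step; rewrite ?lexx ?h//;
      by move: h rho_le mrho rhom m0 r10; clear; lra.
  rewrite distrC; apply: step; rewrite ?lexx ?(ltW h)//;
    by move: h rho_le mrho rhom m0 r10; clear; lra.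
move: telescope half octant; rewrite !ler_norml; lra.
Qed.

Lemma sum_sawtooth_arc (eps : R) : 0 < eps -> exists C, forall r (m : nat),
  0 < r -> m%:R <= r / Num.sqrt 2 ->
  `|\sum_(1 <= a < m.+1) sawtooth (arc r a%:R)| <= eps * r + C.
Proof.
move=> eps0; have B1 : 1 <= 5 :> R by lra.
have [C HC] := sum_sawtooth_small B1 eps0.
exists C => r m r0 mr.
have mr' : m%:R <= 3 / 4 * r.
  by apply: le_trans mr _; case/andP: (octant_point_le r0).
rewrite big_add1 /=.
have bnd a : (a < m)%N -> 0 <= (a.+1%:R : R) <= 4 / 5 * r.
  move=> am; rewrite ler0n /=; have : a.+1%:R <= m%:R :> R by rewrite ler_nat.
  lra.
apply: (HC r m (fun a => arc r a.+1%:R) (fun a => a.+1%:R / arc r a.+1%:R)) => //.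
- lra.
- move=> a am; have := arc_ge r0 (bnd _ am); have /andP[h1 h2] := bnd _ am.
  move=> h; have h' : 0 < arc r a.+1%:R by lra.
  by rewrite divr_ge0 ?(ltW h')//= ler_pdivrMr//; lra.
- move=> a i aim; have am : (a < m)%N by apply: leq_ltn_trans aim; rewrite leq_addr.
  have := arc_tangent r0 (bnd _ am) (bnd _ aim).
  have -> : (a + i).+1%:R - a.+1%:R = i%:R :> R by rewrite -!natr1 natrD; ring.
  move=> h; apply: le_trans h _; rewrite ler_pM2r ?invr_gt0//.
  by rewrite ler_wpM2r ?exprn_ge0//; lra.
- move=> a i aim; have am : (a < m)%N by apply: leq_ltn_trans aim; rewrite leq_addr.
  have /andP[h1 _] := bnd _ am; have /andP[_ h2] := bnd _ aim.
  have h3 : a.+1%:R <= (a + i).+1%:R :> R by rewrite ler_nat ltnS leq_addr.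
  have := arc_slope_gap r0 h1 h3 h2.
  have -> : (a + i).+1%:R - a.+1%:R = i%:R :> R by rewrite -!natr1 natrD; ring.
  move=> /andP[g1 g2]; rewrite g2 andbT; apply: le_trans g1.
  rewrite ler_wpM2l// lef_pV2 ?posrE ?mulr_gt0//; lra.
Qed.

(** The octant formula is 1 + 4 floor r + 4 (2 sum floor(arc a) - m^2).  Writing
    the floor of t as t - 1/2 minus the sawtooth of t, the terms in r and
    in m cancel with those of [sum_arc], up to O(1). *)
Theorem gauss_circle (eps : R) : 0 < eps -> exists C, forall n : nat,
  `|(circle_count n)%:R - pi * n%:R| <= eps * Num.sqrt n%:R + C.
Proof.
move=> eps0; have eps8 : 0 < eps / 8 by lra.
have [C HC] := sum_sawtooth_arc eps8.
(* sum_arc requires r >= 10; the finitely many smaller n go into C0. *)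
pose C0 : R := \sum_(k < 100) `|(circle_count k)%:R - pi * k%:R|.
have C00 : 0 <= C0 by apply: sumr_ge0.
exists (C0 + 8 * `|C| + 40) => n.
have [n100|n100] := ltnP n 100.
  have : 0 <= eps * Num.sqrt n%:R by rewrite mulr_ge0 ?sqrtr_ge0// ltW.
  have : `|(circle_count n)%:R - pi * n%:R| <= C0.
    rewrite /C0 (bigD1 (Ordinal n100))//= lerDl; exact: sumr_ge0.
  by have := normr_ge0 C; lra.
set r : R := Num.sqrt n%:R.
have rE : r ^+ 2 = n%:R by rewrite sqr_sqrtr.
have r10 : 10 <= r.
  have : 0 <= r by exact: sqrtr_ge0.
  have : 100 <= r ^+ 2 by rewrite rE ler_nat.
  by nra.
have r0 : 0 < r by lra.
have /andP[rho0 rho_le] := octant_point_le r0.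
pose m := Num.truncn (r / Num.sqrt 2).
have /andP[mrho rhom] : m%:R <= r / Num.sqrt 2 < m.+1%:R by exact: truncn_itv.
have s2 : 0 < Num.sqrt 2 :> R by rewrite sqrtr_gt0.
have rhoE : (r / Num.sqrt 2) ^+ 2 * 2 = n%:R.
  by rewrite exprMn exprVn rE sqr_sqrtr//; field.
have mn : (2 * m ^ 2 <= n)%N.
  rewrite -(ler_nat R) natrM natrX -rhoE mulrC ler_pM2r//.
  by rewrite lerXn2r// nnegrE.
have nm : (n < 2 * m.+1 ^ 2)%N.
  rewrite -(ltr_nat R) natrM natrX -rhoE mulrC ltr_pM2l//.
  by rewrite ltrXn2r// nnegrE.
have m_le_n a : (a < m.+1)%N -> (a ^ 2 <= n)%N.
  rewrite ltnS => am; apply: leq_trans mn; apply: (@leq_trans (m ^ 2)).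
    by rewrite leq_sqr.
  by rewrite leq_pmull.
have AE : (circle_count n)%:R = 1 + 4 * (Num.truncn r)%:R
   + 4 * (2 * \sum_(1 <= a < m.+1) (Num.truncn (arc r a%:R))%:R - m%:R ^+ 2) :> R.
  rewrite circle_countE natrD natrD !natrM.
  have -> : (\sum_(1 <= b < n.+1) (b ^ 2 <= n))%N = Num.truncn r.
    have := @count_sqrt R n 0 isT; rewrite expr0n /= subr0 -/r => <-.
    by apply: eq_bigr => b _; rewrite exp0n.
  have /(congr1 (fun k => k%:R : R)) := octant_count mn nm.
  rewrite natrD natrM natrX.
  have -> : (\sum_(1 <= a < m.+1) \sum_(1 <= b < n.+1) (a ^ 2 + b ^ 2 <= n))%N%:R
     = \sum_(1 <= a < m.+1) (Num.truncn (arc r a%:R))%:R :> R.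
    rewrite natr_sum; apply: eq_big_nat => a /andP[_ am].
    by rewrite (@count_sqrt R)// ?m_le_n// /arc rE.
  lra.
have floorE : \sum_(1 <= a < m.+1) (Num.truncn (arc r a%:R))%:R
   = \sum_(1 <= a < m.+1) arc r a%:R - \sum_(1 <= a < m.+1) sawtooth (arc r a%:R)
     - m%:R / 2.
  have -> : m%:R / 2 = \sum_(1 <= a < m.+1) 2^-1 :> R.
    by rewrite sumr_const_nat subn1 /= -[RHS]mulr_natl.
  rewrite -!sumrB; apply: eq_bigr => a _; rewrite /sawtooth.
  by rewrite natr_truncn ?arc_ge0//; ring.
have /andP[tr1 tr2] := truncn_itv (ltW r0).
have S := sum_arc r10 (introT andP (conj mrho rhom)).
have := HC r m r0 mrho.
rewrite AE floorE; move: S; rewrite -rE; have := ler_norm C.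
move: tr2; rewrite -natr1.
set X := \sum_(1 <= a < m.+1) arc _ _; set Y := \sum_(1 <= a < m.+1) sawtooth _.
rewrite !ler_norml => h1 h2 /andP[h3 h4] /andP[h5 h6].
move: h3 h4; have -> : (m%:R + 2^-1 : R) ^+ 2 = m%:R ^+ 2 + m%:R + 4^-1 by field.
move=> h3 h4; apply/andP; split; lra.
Qed.
End Arc.

(** * Error terms of order o(x) *)

Section Layers.
Variable R : realType.
Implicit Types (c x eps : R).

(** For g bounded on bounded sets this is g(x) = o(x) at infinity; the
    form with an additive constant needs no threshold on x, and is therefore
    stable under sums and dilations without further bookkeeping. *)
Definition is_small (g : R -> R) := forall eps, 0 < eps ->
  exists C, forall x, 0 <= x -> `|g x| <= eps * x + C.

Lemma is_smallD g1 g2 : is_small g1 -> is_small g2 ->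
  is_small (fun x => g1 x + g2 x).
Proof.
move=> s1 s2 eps e0; have e2 : 0 < eps / 2 by lra.
have [C1 H1] := s1 _ e2; have [C2 H2] := s2 _ e2.
exists (C1 + C2) => x x0; apply: le_trans (ler_normD _ _) _.
by have := H1 x x0; have := H2 x x0; lra.
Qed.

Lemma is_smallZ a g : is_small g -> is_small (fun x => a * g x).
Proof.
move=> s eps e0; have a1 : 0 < `|a| + 1 by rewrite ltr_wpDl.
have [C H] := s _ (divr_gt0 e0 a1).
exists ((`|a| + 1) * C) => x x0; rewrite normrM.
apply: (@le_trans _ _ ((`|a| + 1) * (eps / (`|a| + 1) * x + C))).
  apply: ler_pM => //; first by rewrite lerDl.
  exact: H.
by rewrite le_eqVlt; apply/orP; left; apply/eqP; field; rewrite gt_eqF.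
Qed.

Lemma is_small_dilate m g : 0 < m -> is_small g -> is_small (fun x => g (x / m)).
Proof.
move=> m0 s eps e0; have [C H] := s _ (mulr_gt0 e0 m0).
exists C => x x0; apply: le_trans (H _ _) _; first by rewrite divr_ge0// ltW.
by rewrite le_eqVlt; apply/orP; left; apply/eqP; field; rewrite gt_eqF.
Qed.

Lemma is_small_dominated g1 g2 : (forall x, 0 <= x -> `|g1 x| <= `|g2 x|) ->
  is_small g2 -> is_small g1.
Proof.
move=> le12 s eps e0; have [C H] := s _ e0.
by exists C => x x0; apply: le_trans (le12 x x0) (H x x0).
Qed.

Lemma is_small_cst (b : R) : is_small (fun=> b).
Proof.
move=> eps e0; exists `|b| => x x0; rewrite lerDr mulr_ge0//; exact: ltW.
Qed.

(** Arithmetic-geometric mean: 2 s <= eps s^2 + 1 / eps. *)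
Lemma is_small_sqrt : is_small (fun x => Num.sqrt x).
Proof.
move=> eps e0; exists eps^-1 => x x0; rewrite ger0_norm ?sqrtr_ge0//.
have xE := sqr_sqrtr x0; set s := Num.sqrt x in xE *.
have : 0 <= (eps * s - 1) ^+ 2 / eps by rewrite divr_ge0 ?sqr_ge0// ltW.
have -> : (eps * s - 1) ^+ 2 / eps = eps * s ^+ 2 - 2 * s + eps^-1.
  by field; rewrite gt_eqF.
have : 0 <= eps * s ^+ 2 + eps^-1.
  have e0' := ltW e0; have s20 := sqr_ge0 s.
  by apply: addr_ge0; [apply: mulr_ge0|rewrite invr_ge0].
by rewrite xE; lra.
Qed.

(** The bound is kept in terms of sqrt x, and for all x >= 0: it is going to be
    summed over about sqrt x layers, some of which have bounded radius. *)
Lemma gauss_circle_real eps : 0 < eps -> exists C, forall x, 0 <= x ->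
  `|(circle_count (Num.truncn x))%:R - pi * x| <= eps * Num.sqrt x + C.
Proof.
move=> e0; have pi0 := pi_gt0 R; have [C H] := gauss_circle e0.
exists (C + pi) => x x0.
have /andP[t1 t2] := truncn_itv x0; rewrite -natr1 in t2.
have := H (Num.truncn x).
set t : R := (Num.truncn x)%:R in t1 t2 * => Ht.
have -> : (circle_count (Num.truncn x))%:R - pi * x
  = ((circle_count (Num.truncn x))%:R - pi * t) - pi * (x - t) by ring.
apply: le_trans (ler_normB _ _) _; rewrite addrA; apply: lerD.
  by apply: le_trans Ht _; rewrite lerD2r ler_pM2l// ler_wsqrtr.
rewrite normrM (gtr0_norm pi0) -[leRHS]mulr1 ler_pM2l//.
by rewrite ger0_norm ?subr_ge0//; lra.
Qed.

Lemma circle_count_small :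
  is_small (fun x => (circle_count (Num.truncn x))%:R - pi * x).
Proof.
have [C H] := gauss_circle_real ltr01.
have := is_smallD is_small_sqrt (is_small_cst `|C|).
apply: is_small_dominated => x x0; apply: le_trans (H x x0) _.
rewrite mul1r ger0_norm ?addr_ge0 ?sqrtr_ge0//.
by rewrite lerD2l ler_norm.
Qed.

Lemma r2_0 : r2 0 = 1%N.
Proof.
have := circle_countE 0; rewrite !big_geq// !muln0 !addn0.
by rewrite /circle_count big_ord_recr big_ord0.
Qed.

Lemma circle_count_from1 (n : nat) :
  \sum_(1 <= k < n.+1) (r2 k)%:R = (circle_count n)%:R - 1 :> R.
Proof.
rewrite /circle_count -(big_mkord xpredT r2) big_ltn// r2_0 add1n -natr1 addrK.
by rewrite natr_sum.
Qed.

(** * Layers of the ellipsoid *)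

Definition layer_sum c x : int :=
  \sum_(1 <= n < (Num.truncn x).+1)
     (r2 n)%:Z * Num.floor (c * Num.sqrt (x - n%:R)).

Definition layer_top c x : nat := Num.truncn (c * Num.sqrt x).

Lemma layer_radius_ge0 c x (k : nat) : 0 < c -> 0 <= x ->
  (k < (layer_top c x).+1)%N -> 0 <= x - k%:R ^+ 2 / c ^+ 2.
Proof.
move=> c0 x0; have cs0 : 0 <= c * Num.sqrt x.
  by rewrite mulr_ge0 ?sqrtr_ge0// ltW.
rewrite ltnS truncn_ge_nat// => kc; rewrite subr_ge0 ler_pdivrMr ?exprn_gt0//.
have -> : x * c ^+ 2 = (c * Num.sqrt x) ^+ 2.
  by rewrite exprMn sqr_sqrtr// mulrC.
by rewrite lerXn2r// nnegrE.
Qed.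

(** Exchange of summations: for n <= x, the floor counts the k >= 1 with
    k <= c sqrt (x - n), that is, with n <= x - k^2 / c^2. *)
Lemma layer_sumE c x : 0 < c -> 0 <= x ->
  (layer_sum c x)%:~R = \sum_(1 <= k < (layer_top c x).+1)
    ((circle_count (Num.truncn (x - k%:R ^+ 2 / c ^+ 2)))%:R - 1) :> R.
Proof.
move=> c0 x0; have sx0 := sqrtr_ge0 x.
have y0 (k : nat) : (k < (layer_top c x).+1)%N -> 0 <= x - k%:R ^+ 2 / c ^+ 2.
  exact: layer_radius_ge0.
have floorE n : (1 <= n < (Num.truncn x).+1)%N ->
    (Num.floor (c * Num.sqrt (x - n%:R)))%:~R
    = \sum_(1 <= k < (layer_top c x).+1) (n%:R <= x - k%:R ^+ 2 / c ^+ 2)%R%:R :> R.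
  move=> /andP[_]; rewrite ltnS truncn_ge_nat// => nx.
  have z0 : 0 <= c * Num.sqrt (x - n%:R) by rewrite mulr_ge0 ?sqrtr_ge0// ltW.
  rewrite -natr_truncn//; set q := Num.truncn _.
  have kq (k : nat) : (n%:R <= x - k%:R ^+ 2 / c ^+ 2) = (k <= q)%N.
    rewrite truncn_ge_nat// lerBrDl -lerBrDr ler_pdivrMr ?exprn_gt0//.
    have -> : (x - n%:R) * c ^+ 2 = (c * Num.sqrt (x - n%:R)) ^+ 2.
      by rewrite exprMn sqr_sqrtr ?subr_ge0// mulrC.
    by rewrite ler_sqr ?nnegrE.
  have qtop : (q <= layer_top c x)%N.
    apply: le_truncn; rewrite ler_pM2l//; apply: ler_wsqrtr.
    by rewrite gerBl.
  under eq_bigr => k _ do rewrite kq.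
  rewrite (@big_cat_nat _ _ _ q.+1 1)//= [X in _ + X]big1_seq ?addr0.
    rewrite (eq_big_nat _ _ (F2 := fun=> 1)); last first.
      by move=> b /andP[_]; rewrite ltnS => ->.
    by rewrite sumr_const_nat subn1.
  by move=> b; rewrite mem_index_iota => /andP[_ /andP[kb _]]; rewrite leqNgt kb.
rewrite /layer_sum rmorph_sum /=.
transitivity (\sum_(1 <= n < (Num.truncn x).+1)
  \sum_(1 <= k < (layer_top c x).+1)
    (r2 n)%:R * (n%:R <= x - k%:R ^+ 2 / c ^+ 2)%R%:R : R).
  by apply: eq_big_nat => n nx; rewrite rmorphM /= floorE// mulr_sumr.
rewrite exchange_big /=; apply: eq_big_nat => k /andP[_ kK].
set y := x - _; have yx : y <= x by rewrite gerBl divr_ge0// sqr_ge0.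
have ty : (Num.truncn y <= Num.truncn x)%N by exact: le_truncn.
rewrite -circle_count_from1.
rewrite (@big_cat_nat _ _ _ (Num.truncn y).+1 1)//= [X in _ + X]big1_seq ?addr0.
  apply: eq_big_nat => n /andP[_]; rewrite ltnS truncn_ge_nat; last exact: y0.
  by move=> ->; rewrite mulr1.
move=> n; rewrite mem_index_iota => /andP[_ /andP[yn _]].
by rewrite -(truncn_ge_nat _ (y0 k kK)) leqNgt yn mulr0.
Qed.

Lemma sum_sqr_natr (K : nat) : \sum_(1 <= k < K.+1) k%:R ^+ 2
  = K%:R * (K%:R + 1) * (2 * K%:R + 1) / 6 :> R.
Proof.
elim: K => [|K IH]; first by rewrite big_geq// !mul0r.
by rewrite big_nat_recr//= IH -!natr1; field.
Qed.

(** The sum is a polynomial in K = floor (c s), s = sqrt x.  Expanded in powers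
    of s with K = c s - th and 0 <= th <= 1, the terms of order s^3 and s^2 do
    not involve th: the summand vanishes at the end point k = c s, so the
    rounding of the end point is a second-order effect. *)
Lemma sum_layer_radii_small c : 0 < c ->
  is_small (fun x =>
    \sum_(1 <= k < (layer_top c x).+1) (x - k%:R ^+ 2 / c ^+ 2)
     - (2 / 3 * c * (x * Num.sqrt x) - x / 2)).
Proof.
move=> c0.
have := is_smallD (is_smallZ (7 / (6 * c)) is_small_sqrt)
  (is_small_cst (c ^+ 2)^-1).
apply: is_small_dominated => x x0 /=; have s0 := sqrtr_ge0 x.
have cs0 : 0 <= c * Num.sqrt x by rewrite mulr_ge0// ltW.
have /andP[K1 K2] := truncn_itv cs0; rewrite -natr1 in K2.
rewrite sumrB sumr_const_nat subn1 /= -mulr_suml sum_sqr_natr -[x *+ _]mulr_natl.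
rewrite /layer_top; set K : R := (Num.truncn _)%:R in K1 K2 *.
have xE := sqr_sqrtr x0; set s := Num.sqrt x in s0 cs0 xE K1 K2 *.
pose th := c * s - K.
have th0 : 0 <= th by rewrite subr_ge0.
have th1 : th <= 1 by rewrite /th; lra.
rewrite (@ger0_norm _ (7 / (6 * c) * s + _)); last first.
  have c0' := ltW c0.
  apply: addr_ge0; last by rewrite invr_ge0 exprn_ge0.
  by apply: mulr_ge0 => //; rewrite divr_ge0// mulr_ge0.
have -> : K * x - K * (K + 1) * (2 * K + 1) / 6 / c ^+ 2
    - (2 / 3 * c * (x * s) - x / 2)
  = - (c * s * (6 * (th ^+ 2 - th) + 1)
       + (3 * th ^+ 2 - 2 * th ^+ 3 - th)) / (6 * c ^+ 2).
  have -> : K = c * s - th by rewrite /th; ring.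
  by rewrite -xE; field; rewrite gt_eqF.
have -> : 7 / (6 * c) * s + (c ^+ 2)^-1 = (c * s * 7 + 6) / (6 * c ^+ 2).
  by field; rewrite gt_eqF.
have d0 : 0 < 6 * c ^+ 2 by rewrite mulr_gt0// exprn_gt0.
rewrite normrM normfV (gtr0_norm d0) ler_pM2r ?invr_gt0// normrN.
have p1 : 0 <= th ^+ 2 <= 1 by rewrite exprn_ge0//= exprn_ile1.
have p2 : 0 <= th ^+ 3 <= 1 by rewrite exprn_ge0//= exprn_ile1.
apply: le_trans (ler_normD _ _) _; apply: lerD.
  rewrite normrM (ger0_norm cs0) ler_wpM2l// ler_norml.
  by move: p1 => /andP[? ?]; apply/andP; split; lra.
by rewrite ler_norml; move: p1 p2 => /andP[? ?] /andP[? ?]; apply/andP; split; lra.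
Qed.

(** Each of the at most c sqrt x layers carries an error eps' sqrt x + O(1); the
    choice eps' = eps / (4 c) makes their total eps x / 4 + O(sqrt x). *)
Lemma layer_sum_small c : 0 < c ->
  is_small (fun x => (layer_sum c x)%:~R
    - pi * (2 / 3 * c * (x * Num.sqrt x) - x / 2)).
Proof.
move=> c0 eps e0.
have e1 : 0 < eps / (4 * c) by rewrite divr_gt0// mulr_gt0.
have e2 : 0 < eps / 4 by lra.
have [C1 H1] := gauss_circle_real e1.
have [C2 H2] := is_smallZ (c * (`|C1| + 1)) is_small_sqrt e2.
have [C3 H3] := is_smallZ pi (sum_layer_radii_small c0) e2.
exists (C2 + C3) => x x0; have s0 := sqrtr_ge0 x.
have /= := H2 x x0; have /= := H3 x x0.
set E := pi * _ => HE HS.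
have cs0 : 0 <= c * Num.sqrt x by rewrite mulr_ge0// ltW.
have /andP[K1 _] := truncn_itv cs0.
have y0 (k : nat) := @layer_radius_ge0 c x k c0 x0.
set y := fun k : nat => x - k%:R ^+ 2 / c ^+ 2.
have -> : (layer_sum c x)%:~R - pi * (2 / 3 * c * (x * Num.sqrt x) - x / 2)
  = \sum_(1 <= k < (layer_top c x).+1)
      ((circle_count (Num.truncn (y k)))%:R - pi * y k - 1) + E.
  rewrite layer_sumE// /E [X in _ = _ + X]mulrBr mulr_sumr addrA -big_split /=.
  congr (_ - _).
  by apply: eq_bigr => k _; rewrite /y; ring.
apply: le_trans (ler_normD _ _) _.
have : `|\sum_(1 <= k < (layer_top c x).+1)
      ((circle_count (Num.truncn (y k)))%:R - pi * y k - 1)|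
    <= (layer_top c x)%:R * (eps / (4 * c) * Num.sqrt x + (`|C1| + 1)).
  apply: le_trans (ler_norm_sum _ _ _) _.
  apply: (@le_trans _ _ (\sum_(1 <= k < (layer_top c x).+1)
     (eps / (4 * c) * Num.sqrt x + (`|C1| + 1)))); last first.
    by rewrite sumr_const_nat subn1 /= -[leLHS]mulr_natl.
  apply: ler_sum_nat => k /andP[_ kK].
  apply: le_trans (ler_normB _ _) _; rewrite normr1 addrA lerD2r.
  apply: le_trans (H1 _ (y0 k kK)) _; apply: lerD; last exact: ler_norm.
  by rewrite ler_pM2l//; apply: ler_wsqrtr; rewrite gerBl divr_ge0// sqr_ge0.
have : (layer_top c x)%:R * (eps / (4 * c) * Num.sqrt x + (`|C1| + 1))
    <= c * Num.sqrt x * (eps / (4 * c) * Num.sqrt x + (`|C1| + 1)).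
  by apply: ler_wpM2r => //; rewrite addr_ge0// mulr_ge0// ltW.
have -> : c * Num.sqrt x * (eps / (4 * c) * Num.sqrt x + (`|C1| + 1))
    = eps / 4 * x + c * (`|C1| + 1) * Num.sqrt x.
  by rewrite -{3}(sqr_sqrtr x0); field; rewrite gt_eqF.
have := ler_norm (c * (`|C1| + 1) * Num.sqrt x).
have : 0 <= eps * x by rewrite mulr_ge0// ltW.
lra.
Qed.

Lemma powR_3half (a : R) : 0 <= a -> a `^ (3 / 2) = a * Num.sqrt a.
Proof.
move=> a0; have -> : 3 / 2 = 1 + 2^-1 :> R by field.
by rewrite powRD ?powRr1 ?powR12_sqrt//; apply/implyP; lra.
Qed.

Lemma eqaddo_small (f g e : R -> R) :
  (forall L, 0 < L -> f L = g L + e L) -> is_small e ->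
  f = g +o_+oo (fun L : R => L).
Proof.
move=> fE se; apply/eqaddoP => eps e0.
have e2 : 0 < eps / 2 by lra.
have [C H] := se _ e2.
exists (`|C| / (eps / 2)); split; first exact: num_real.
move=> L LC /=; have L0 : 0 < L by apply: le_lt_trans LC; rewrite divr_ge0// ltW.
rewrite !fctE fE// addrAC subrr add0r (gtr0_norm L0).
apply: le_trans (H L (ltW L0)) _.
move: LC; rewrite ltr_pdivrMr// mulrC => LC; have := ler_norm C; lra.
Qed.

End Layers.

(** * The two counting functions *)

Section Modes.
Variable R : realType.

(** The factor 2 floor(..) + 1 splits the sum at L / mu into twice a layer sum
    and the layer k = 0; their terms of order L cancel. *)
Lemma N_DF_expansion (h lambda mu : R) :
  0 < h -> 0 < mu -> 0 < 3 * lambda + 2 * mu ->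
  exists2 e : R -> R, is_small e &
    forall L, 0 < L ->
      (N_DF h lambda mu L)%:~R =
         2 * h / 3
           * (2 / mu `^ (3 / 2) + 1 / (lambda + 2 * mu) `^ (3 / 2))
           * L `^ (3 / 2)
         - pi / (2 * (lambda + 2 * mu)) * L + e L.
Proof.
move=> h0 mu0 lm0; set nu := lambda + 2 * mu.
have nu0 : 0 < nu by rewrite /nu; lra.
have pi0 := pi_gt0 R; pose c := h / pi.
have c0 : 0 < c by rewrite divr_gt0.
pose E x : R := (layer_sum c x)%:~R - pi * (2 / 3 * c * (x * Num.sqrt x) - x / 2).
pose D x : R := (circle_count (Num.truncn x))%:R - pi * x.
pose T x : R := (Num.floor (c * Num.sqrt x))%:~R.
have Tsmall : is_small T.
  have := is_smallZ c (@is_small_sqrt R); apply: is_small_dominated => x x0.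
  have cs0 : 0 <= c * Num.sqrt x by rewrite mulr_ge0 ?sqrtr_ge0// ltW.
  by rewrite /T -natr_truncn// !ger0_norm// truncn_le.
have Es := layer_sum_small c0.
have Ds := @circle_count_small R.
pose e L := T (L / nu) + (2 * E (L / mu) + (D (L / mu) + (-1 + E (L / nu)))).
exists e.
  apply: is_smallD; first exact: (is_small_dilate nu0 Tsmall).
  apply: is_smallD; first exact: (is_smallZ 2 (is_small_dilate mu0 Es)).
  apply: is_smallD; first exact: (is_small_dilate mu0 Ds).
  apply: is_smallD; first exact: is_small_cst.
  exact: (is_small_dilate nu0 Es).
move=> L L0.
have DFE : (N_DF h lambda mu L)%:~R = T (L / nu)
    + (2 * (layer_sum c (L / mu))%:~R
       + ((circle_count (Num.truncn (L / mu)))%:R - 1))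
    + (layer_sum c (L / nu))%:~R.
  rewrite /N_DF -/nu -/c !rmorphD /= -/(T _) -/(layer_sum c (L / nu)).
  congr (_ + _ + _).
  rewrite -circle_count_from1 /layer_sum.
  rewrite !rmorph_sum mulr_sumr -big_split /=; apply: eq_bigr => n _.
  by rewrite !rmorphM rmorphD rmorphM /=; ring.
rewrite DFE /e /E /D !powR_3half ?ltW//.
have pih : pi * c = h by rewrite /c mulrC divfK// gt_eqF.
have sL := sqrtr_ge0 L.
have dil m : 0 < m -> L / m * Num.sqrt (L / m)
    = L * Num.sqrt L * (m * Num.sqrt m)^-1.
  move=> m0; rewrite sqrtrM ?ltW// sqrtrV ?ltW//.
  by field; rewrite !gt_eqF ?sqrtr_gt0.
rewrite !dil// -pih.
have m1 : Num.sqrt mu != 0 by rewrite gt_eqF// sqrtr_gt0.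
have m2 : Num.sqrt nu != 0 by rewrite gt_eqF// sqrtr_gt0.
by field; rewrite m1 m2 !gt_eqF.
Qed.

End Modes.

Unset Implicit Arguments.

Theorem proposition3p6 (R : realType) (h lambda mu : R)
  (h_gt0 : 0 < h) (mu_gt0 : 0 < mu) (lambda_mu_gt0 : 0 < 3 * lambda + 2 * mu) :
  (fun L : R => (N_DF h lambda mu L)%:~R : R)
    = (fun L : R =>
         2 * h / 3
           * (2 / mu `^ (3 / 2) + 1 / (lambda + 2 * mu) `^ (3 / 2))
           * L `^ (3 / 2)
         - pi / (2 * (lambda + 2 * mu)) * L)
      +o_+oo (fun L : R => L)
  /\
  (fun L : R => (N_FD h lambda mu L)%:~R : R)
    = (fun L : R =>
         2 * h / 3
           * (2 / mu `^ (3 / 2) + 1 / (lambda + 2 * mu) `^ (3 / 2))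
           * L `^ (3 / 2)
         + pi / (2 * (lambda + 2 * mu)) * L)
      +o_+oo (fun L : R => L).
Proof.
have [e e_small DFE] := N_DF_expansion h_gt0 mu_gt0 lambda_mu_gt0.
split; first exact: (eqaddo_small DFE).
set nu := lambda + 2 * mu; have nu0 : 0 < nu by rewrite /nu; lra.
have Ds := is_small_dilate nu0 (@circle_count_small R).
apply: (eqaddo_small _ (is_smallD e_small (is_smallD Ds (is_small_cst (-1))))).
move=> L L0; rewrite /N_FD rmorphD /= DFE// rmorph_sum -/nu /=.
have -> : \sum_(1 <= n < (Num.truncn (L / nu)).+1) (r2 n)%:Z%:~R
    = (circle_count (Num.truncn (L / nu)))%:R - 1 :> R.
  by rewrite -circle_count_from1.
by field; rewrite !gt_eqF ?powR_gt0.
Qed.
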